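(* Suppose the basic assumptions (i)–(vi) listed in the context hold, that the pair $(f_1,h)$ is $L$-smad on $C$ for some $L>0$, and that $\mathcal{T}_{\lambda'}(x)\subset C$ for all $x\in C$ and all $\lambda'>0$. Suppose moreover that: (a) $\operatorname{dom} h=\mathbb{R}^d$ and $h$ is $\sigma$-strongly convex on $\mathbb{R}^d$ (for some $\sigma>0$); (b) $\nabla h$ and $\nabla f_1$ are Lipschitz continuous on any bounded subset of $\mathbb{R}^d$; (c) $\Psi$ is level-bounded, i.e., for every $r\in\mathbb{R}$ the set $\{x\in\mathbb{R}^d\mid \Psi(x)\le r\}$ is bounded; (d) $f_2$ is continuously differentiable on an open set $\mathcal{N}_0\subset\mathbb{R}^d$ that contains the set $\mathcal{X}$ of all limiting critical points of $(\mathcal{P})$, and $\nabla f_2$ is locally Lipschitz continuous on $\mathcal{N}_0$. Let $\{x^k\}_{k=0}^\infty$ be a sequence generated by BPDCA with $0<\lambda L<1$ and suppose that $\{x^k\}_{k=0}^\infty$ converges to some $\tilde x\in\mathcal{X}$. Suppose further that $\Psi$ is a KL function with the function $\phi$ in the KL inequality taking the form $\phi(s)=cs^{1-\theta}$ for some $\theta\in[0,1)$ and $c>0$. Then: (i) if $\theta=0$, there exists $k_0>0$ such that $x^k$ is constant for $k>k_0$; (ii) if $\theta\in(0,\frac12]$, there exist $c_1>0$, $k_1>0$ and $\eta\in(0,1)$ such that $\|x^k-\tilde x\|<c_1\eta^k$ for $k>k_1$; (iii) if $\theta\in(\frac12,1)$, there exist $c_2>0$ and $k_2>0$ such that $\|x^k-\tilde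 x\|<c_2k^{-\frac{1-\theta}{2\theta-1}}$ for $k>k_2$.
   Context: $\|\cdot\|$ is the Euclidean norm, $C\subset\mathbb{R}^d$ is a nonempty, convex, open set, $\overline{C}$ its closure. For convex $f$, $\partial_{\mathrm c}f(x)=\{\xi\in\mathbb{R}^d\mid f(y)-f(x)-\langle\xi,y-x\rangle\ge 0\ \forall y\in\mathbb{R}^d\}$. Limiting subdifferential: for proper lower semicontinuous $f$ and $x\in\operatorname{dom} f$, $\partial f(x)$ is the set of $\xi\in\mathbb{R}^d$ for which there exist $x^k\to x$ with $f(x^k)\to f(x)$ and $\xi^k\to\xi$ such that $\liminf_{y\to x^k,\,y\ne x^k}\frac{f(y)-f(x^k)-\langle\xi^k,y-x^k\rangle}{\|y-x^k\|}\ge 0$ for each $k$. Kernel generating distance: $h\in\mathcal{G}(C)$ means $h:\mathbb{R}^d\to(-\infty,+\infty]$ is proper, lower semicontinuous and convex, $\operatorname{dom} h\subset\overline{C}$, $\operatorname{dom}\partial h=C$, and $h$ is $\mathcal{C}^1$ on $\operatorname{int}\operatorname{dom} h=C$. Bregman distance: $D_h(x,y)=h(x)-h(y)-\langle\nabla h(y),x-y\rangle$ for $x\in\operatorname{dom} h$, $y\in C$. $L$-smad: $(f,h)$ is $L$-smooth adaptable ($L$-smad) on $C$, $L>0$, if $h\in\mathcal{G}(C)$, $f:\mathbb{R}^d\to(-\infty,+\infty]$ is proper and lower semicontinuous with $\operatorname{dom} h\subset\operatorname{dom} f$ and $\mathcal{C}^1$ on $C$, and $Lh-f$ and $Lh+f$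 are convex on $C$. Problem $(\mathcal{P})$: minimize $\Psi(x)=f_1(x)-f_2(x)+g(x)$ over $x\in\overline{C}$. Basic assumptions: (i) $h\in\mathcal{G}(C)$ with $\overline{C}=\overline{\operatorname{dom} h}$; (ii) $f_1:\mathbb{R}^d\to(-\infty,+\infty]$ is proper and convex with $\operatorname{dom} h\subset\operatorname{dom}(f_1+g)$, and $\mathcal{C}^1$ on $C$; (iii) $f_2:\mathbb{R}^d\to(-\infty,+\infty]$ is proper and convex; (iv) $g:\mathbb{R}^d\to(-\infty,+\infty]$ is proper and lower semicontinuous with $\operatorname{dom} g\cap C\neq\emptyset$; (v) $v(\mathcal{P}):=\inf\{\Psi(x)\mid x\in\overline{C}\}>-\infty$; (vi) for any $\lambda>0$, $\lambda g+h$ is supercoercive: $\lim_{\|u\|\to\infty}\frac{\lambda g(u)+h(u)}{\|u\|}=\infty$. For $x\in C$, $\xi\in\partial_{\mathrm c}f_2(x)$, $\lambda>0$: $\mathcal{T}_\lambda(x):=\operatorname{argmin}_{u\in\overline{C}}\{g(u)+\langle\nabla f_1(x)-\xi,u-x\rangle+\frac1\lambda D_h(u,x)\}$. BPDCA: choose $x^0\in C$ and $0<\lambda<1/L$; for $k=0,1,2,\dots$ take any $\xi^k\in\partial_{\mathrm c}f_2(x^k)$ and let $x^{k+1}$ be a minimizer over $x\in\overline{C}$ of $g(x)+\langle\nabla f_1(x^k)-\xi^k,x-x^k\rangle+\frac1\lambda D_h(x,x^k)$. When $C=\mathbb{R}^d$: $\tilde x$ is a limiting critical point of $(\mathcal{P})$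 if $0\in\nabla f_1(\tilde x)-\partial_{\mathrm c}f_2(\tilde x)+\partial g(\tilde x)$; the set of these is $\mathcal{X}$. KL property: for $\eta>0$, $\Xi_\eta$ is the set of continuous concave $\phi:[0,\eta)\to\mathbb{R}_+$, $\mathcal{C}^1$ on $(0,\eta)$ with positive derivative, $\phi(0)=0$. A proper lower semicontinuous $f$ has the KL property at $\hat x\in\operatorname{dom}\partial f$ if there are $\eta\in(0,+\infty]$, a neighborhood $U$ of $\hat x$ and $\phi\in\Xi_\eta$ such that the KL inequality $\phi'(f(x)-f(\hat x))\cdot\operatorname{dist}(0,\partial f(x))\ge 1$ holds for all $x\in U$ with $f(\hat x)<f(x)<f(\hat x)+\eta$. $f$ is a KL function if it has the KL property at each point of $\operatorname{dom}\partial f$. *)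

(* Defs.v *)
From HB Require Import structures.
From mathcomp Require Import all_boot all_order all_algebra.
From mathcomp Require Import all_classical all_reals all_analysis.

Set Implicit Arguments.
Unset Strict Implicit.
Unset Printing Implicit Defensive.

Import Order.TTheory GRing.Theory Num.Theory.
Import numFieldNormedType.Exports.

Local Open Scope classical_set_scope.
Local Open Scope ring_scope.

(* R^d is 'rV[R]_d.  The library norm `|x| on 'rV[R]_d is the sup norm, so the
   Euclidean norm is defined here; both induce the library topology, from which
   closures, interiors, limits, continuity and boundedness are taken. *)

Section euclidean.
Context {R : realType} {d : nat}.
Implicit Types (x y : 'rV[R]_d) (A : set 'rV[R]_d).

Definition dotv x y : R := \sum_(i < d) x 0 i * y 0 i.

Definition enorm x : R := Num.sqrt (dotv x x).

(* +oo when A is empty *)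
Definition dist_to_set x A : \bar R := ereal_inf [set (enorm (x - y))%:E | y in A].

Definition lipschitz_in (F : 'rV[R]_d -> 'rV[R]_d) A :=
  exists M : R, forall x y, A x -> A y ->
    enorm (F x - F y) <= M * enorm (x - y).

Definition lipschitz_on_bounded (F : 'rV[R]_d -> 'rV[R]_d) :=
  forall B, bounded_set B -> lipschitz_in F B.

Definition locally_lipschitz_on (F : 'rV[R]_d -> 'rV[R]_d) A :=
  forall x, A x -> exists2 U, nbhs x U & lipschitz_in F (U `&` A).

End euclidean.

(* Functions R^d -> (-oo, +oo] are rendered as functions into \bar R that are
   required to avoid -oo by properness. *)
Section extended_valued_functions.
Context {R : realType} {d : nat}.
Implicit Types (f : 'rV[R]_d -> \bar R) (x y xi : 'rV[R]_d) (A : set 'rV[R]_d).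
Local Open Scope ereal_scope.

Definition dom f : set 'rV[R]_d := [set x | f x < +oo].

Definition proper f := (forall x, -oo < f x) /\ dom f !=set0.

(* In \bar R, 0 * +oo = 0, so that t = 0 and t = 1 impose nothing. *)
Definition econvex_on A f :=
  forall x y (t : R), A x -> A y -> (0 <= t <= 1)%R ->
    f (t *: x + (1 - t) *: y)%R <= t%:E * f x + (1 - t)%:E * f y.

Definition econvex f := econvex_on setT f.

Definition strongly_convex (sigma : R) f :=
  forall x y (t : R), (0 <= t <= 1)%R ->
    f (t *: x + (1 - t) *: y)%R + (sigma / 2 * t * (1 - t) * enorm (x - y) ^+ 2)%:E
      <= t%:E * f x + (1 - t)%:E * f y.

Definition supercoercive f :=
  forall A : R, \forall r \near +oo%R, forall x, (r <= enorm x)%R ->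
    A%:E <= f x * ((enorm x)^-1)%:E.

Definition level_bounded f :=
  forall r : R, bounded_set [set x | f x <= r%:E].

Definition grad f x : 'rV[R]_d :=
  \row_(i < d) 'D_(delta_mx ord0 i : 'rV[R]_d) (fine \o f) x.

(* Meant for open A: differentiability at x in A is that of the whole-space
   function. *)
Definition C1_on A f :=
  [/\ forall x, A x -> f x \is a fin_num,
      forall x, A x -> differentiable (fine \o f) x &
      forall x, A x -> {for x, continuous (grad f)}].

(* For proper f this is empty outside dom f: there f y - f x = -oo, also when
   f y = +oo. *)
Definition csubdiff f x : set 'rV[R]_d :=
  [set xi | forall y, 0 <= f y - f x - (dotv xi (y - x))%:E].

(* x^' is the punctured neighborhood filter *)
Definition frechet_subdiff f x : set 'rV[R]_d :=
  [set xi | dom f x /\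
    0 <= limf_einf (fun y => (f y - f x - (dotv xi (y - x))%:E)
                             * ((enorm (y - x))^-1)%:E) x^'].

Definition lsubdiff f x : set 'rV[R]_d :=
  [set xi | dom f x /\
    exists xs xis : nat -> 'rV[R]_d,
      [/\ xs k @[k --> \oo] --> x,
          f (xs k) @[k --> \oo] --> f x,
          xis k @[k --> \oo] --> xi &
          forall k, frechet_subdiff f (xs k) (xis k)]].

Definition dom_lsubdiff f : set 'rV[R]_d := [set x | lsubdiff f x !=set0].

End extended_valued_functions.

Section bregman.
Context {R : realType} {d : nat}.
Implicit Types (f g h : 'rV[R]_d -> \bar R) (C : set 'rV[R]_d).
Local Open Scope ereal_scope.

Record kernel_generating C h : Prop := {
  kgd_proper : proper h;
  kgd_lsc : lower_semicontinuous h;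
  kgd_convex : econvex h;
  kgd_dom : dom h `<=` closure C;
  kgd_dom_subdiff : dom_lsubdiff h = C;
  kgd_int_dom : interior (dom h) = C;
  kgd_C1 : C1_on C h }.

Definition bregman h (x y : 'rV[R]_d) : \bar R :=
  h x - h y - (dotv (grad h y) (x - y))%:E.

Record smad C (L : R) f h : Prop := {
  smad_L : (0 < L)%R;
  smad_kernel : kernel_generating C h;
  smad_proper : proper f;
  smad_lsc : lower_semicontinuous f;
  smad_dom : dom h `<=` dom f;
  smad_C1 : C1_on C f;
  smad_minus : econvex_on C (fun x => L%:E * h x - f x);
  smad_plus : econvex_on C (fun x => L%:E * h x + f x) }.

End bregman.

Section dc_problem.
Context {R : realType} {d : nat}.
Variables (C : set 'rV[R]_d) (f1 f2 g h : 'rV[R]_d -> \bar R).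
Local Open Scope ereal_scope.

(* In \bar R, +oo - +oo = -oo; the convention is immaterial wherever f1 and g
   are finite, in particular on dom h under the basic assumptions. *)
Definition Psi (x : 'rV[R]_d) : \bar R := f1 x - f2 x + g x.

Record basic_assumptions : Prop := {
  ba_kernel : kernel_generating C h;
  ba_closure : closure C = closure (dom h);
  ba_f1_proper : proper f1;
  ba_f1_convex : econvex f1;
  ba_f1_dom : dom h `<=` dom (f1 \+ g);
  ba_f1_C1 : C1_on C f1;
  ba_f2_proper : proper f2;
  ba_f2_convex : econvex f2;
  ba_g_proper : proper g;
  ba_g_lsc : lower_semicontinuous g;
  ba_g_dom : dom g `&` C !=set0;
  ba_value : -oo < ereal_inf [set Psi x | x in closure C];
  ba_supercoercive : forall lam : R, (0 < lam)%R ->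
    supercoercive (fun u => lam%:E * g u + h u) }.

Definition subproblem (lam : R) (x xi u : 'rV[R]_d) : \bar R :=
  g u + (dotv (grad f1 x - xi) (u - x))%:E + (lam^-1)%:E * bregman h u x.

Definition bpdca_map (lam : R) (x xi : 'rV[R]_d) : set 'rV[R]_d :=
  [set u | closure C u /\
    forall v, closure C v -> subproblem lam x xi u <= subproblem lam x xi v].

Definition is_BPDCA (lam : R) (xs : nat -> 'rV[R]_d) :=
  C (xs 0%N) /\
  exists xis : nat -> 'rV[R]_d, forall k,
    csubdiff f2 (xs k) (xis k) /\ bpdca_map lam (xs k) (xis k) (xs k.+1).

Definition limiting_critical : set 'rV[R]_d :=
  [set x | exists xi zeta, [/\ csubdiff f2 x xi, lsubdiff g x zeta &
                               0%R = (grad f1 x - xi + zeta)%R]].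

End dc_problem.

Section kurdyka_lojasiewicz.
Context {R : realType} {d : nat}.
Implicit Types (eta : \bar R) (phi : R -> R) (f : 'rV[R]_d -> \bar R).
Local Open Scope ereal_scope.

(* [0, eta[ with eta possibly +oo *)
Definition KL_domain eta : set R := [set s | (0 <= s)%R /\ s%:E < eta].

(* phi is total; only its values on [0, eta[ matter. *)
Record desingularizing eta phi : Prop := {
  desing_continuous : {within KL_domain eta, continuous phi};
  desing_concave : convex_function (KL_domain eta) (\- phi)%R;
  desing_ge0 : forall s : R, KL_domain eta s -> (0 <= phi s)%R;
  desing_derivable : forall s : R, (0 < s)%R -> s%:E < eta -> derivable phi s 1%R;
  desing_C1 : forall s : R, (0 < s)%R -> s%:E < eta ->
    {for s, continuous (derive1 phi)};
  desing_pos : forall s : R, (0 < s)%R -> s%:E < eta -> (0 < derive1 phi s)%R;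
  desing_0 : phi 0%R = 0%R }.

(* KL property at xh, with the desingularizing function phi required to be of
   the shape Phi eta on [0, eta[. *)
Definition KL_at (Phi : \bar R -> (R -> R) -> Prop) f (xh : 'rV[R]_d) :=
  exists eta (U : set 'rV[R]_d) phi,
    [/\ 0 < eta, nbhs xh U, desingularizing eta phi, Phi eta phi &
        forall x, U x -> f xh < f x -> f x < f xh + eta ->
          1 <= (derive1 phi (fine (f x - f xh)))%:E * dist_to_set 0%R (lsubdiff f x)].

Definition KL_function (Phi : \bar R -> (R -> R) -> Prop) f :=
  [/\ proper f, lower_semicontinuous f &
      forall xh, dom_lsubdiff f xh -> KL_at Phi f xh].

Definition power_shape (theta : R) eta phi :=
  exists2 c : R, (0 < c)%R &
    forall s : R, KL_domain eta s -> phi s = (c * s `^ (1 - theta))%R.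

End kurdyka_lojasiewicz.

(* Main.v *)
(* Since dom h = R^d, C = R^d and all four functions are finite.  Testing
   the subproblem at x^k gives Psi(x^{k+1}) + a |x^{k+1} - x^k|^2 <= Psi(x^k);
   its optimality condition at x^{k+1}, once the iterates have entered N0,
   gives a Frechet subgradient of Psi of norm at most M |x^{k+1} - x^k|;
   testing it at the limit gives Psi(x^k) -> Psi(xtilde).  With
   r_k = Psi(x^k) - Psi(xtilde), s_k = |x^{k+1} - x^k| and q = 1 - theta, the KL
   inequality becomes r_{k+1}^{1-q} <= b s_k.  Concavity of t |-> t^q and AM-GM
   turn this into 2 s_{k+1} <= s_k + B (r_{k+1}^q - r_{k+2}^q), whose telescoped
   sum bounds |x^{k+1} - xtilde| by O(r_k^{1/2} + r_k^q); the recursion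
   r_{k+1}^{2(1-q)} <= K (r_k - r_{k+1}) gives the decay of r_k. *)
Require Import Defs.
From HB Require Import structures.
From mathcomp Require Import all_boot all_order all_algebra.
From mathcomp Require Import all_classical all_reals all_analysis.
From mathcomp Require Import lra ring.
Import Order.TTheory GRing.Theory Num.Theory.
Import numFieldNormedType.Exports.
Local Open Scope classical_set_scope.
Local Open Scope ring_scope.

Set Implicit Arguments.
Unset Strict Implicit.
Unset Printing Implicit Defensive.

(** * Power inequalities *)

(** Young's inequality for t^q and 1 with conjugate exponents 1/q and 1/(1 - q). *)
Lemma powR_le_affine (R : realType) (q t : R) :
  0 < q < 1 -> 0 <= t -> t `^ q <= q * t + (1 - q).
Proof.
move=> /andP[q0 q1] t0.
have p0 : 0 < 1 - q by rewrite subr_gt0.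
have := @conjugate_powR R (t `^ q) 1 q^-1 (1 - q)^-1 (powR_ge0 _ _) ler01.
rewrite !invr_gt0 !invrK => /(_ q0 p0).
rewrite addrC subrK => /(_ erefl).
by rewrite -powRrM divff ?gt_eqF// powRr1// powR1 !(mulr1, mul1r) [t * q]mulrC.
Qed.

(** The power lies below its tangent at [a]: the affine bound at t = b/a, scaled by a^q. *)
Lemma powR_tangent (R : realType) (q a b : R) : 0 < q < 1 -> 0 < a -> 0 <= b ->
  b `^ q <= a `^ q + q * a `^ (q - 1) * (b - a).
Proof.
move=> q01 a0 b0.
have /ler_wpM2l : 0 <= a `^ q by exact: powR_ge0.
move=> /(_ _ _ (powR_le_affine q01 (divr_ge0 b0 (ltW a0)))).
rewrite -powRM ?divr_ge0 ?(ltW a0)// mulrCA divff ?gt_eqF// mulr1.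
move=> /le_trans; apply.
rewrite (@powRB _ a q 1) ?(gt_eqF a0) ?implybT// powRr1 ?(ltW a0)//.
rewrite le_eqVlt; apply/orP; left; apply/eqP; field.
by rewrite gt_eqF.
Qed.

(** Write b^-p as a^-p exp(-p ln(b/a)), then combine exp y >= 1 + y with ln t <= t - 1. *)
Lemma powRN_tangent (R : realType) (p a b : R) : 0 < p -> 0 < a -> 0 < b ->
  a `^ (- p) + p * a `^ (- (1 + p)) * (a - b) <= b `^ (- p).
Proof.
move=> p0 a0 b0.
have t0 : 0 < b / a by rewrite divr_gt0.
have lnt : ln (b / a) <= b / a - 1.
  have -> : b / a = 1 + (b / a - 1) by rewrite addrC subrK.
  by apply: le_trans (le_ln1Dx _) _; lra.
have -> : b `^ (- p) = a `^ (- p) * expR (- p * ln (b / a)).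
  have {1}-> : b = a * (b / a) by rewrite mulrC divfK// gt_eqF.
  by rewrite powRM ?ltW//; congr (_ * _); rewrite /powR gt_eqF.
have -> : a `^ (- (1 + p)) = a `^ (- p) / a.
  by rewrite opprD addrC powRD ?(gt_eqF a0) ?implybT// powR_inv1 ?ltW.
have -> : a `^ (- p) + p * (a `^ (- p) / a) * (a - b)
    = a `^ (- p) * (1 + - p * (b / a - 1)).
  by field; rewrite gt_eqF.
rewrite ler_pM2l ?powR_gt0//; apply: le_trans (expR_ge1Dx _).
by rewrite lerD2l !mulNr lerN2 ler_pM2l.
Qed.

(* Convexity of t |-> t^-p when a <= 2 b, crude monotonicity otherwise. *)
Lemma inverse_power_increment (R : realType) (p K : R) : 0 < p -> 0 < K ->
  exists2 mu, 0 < mu & forall a b : R, 0 < b -> b <= a -> a <= 1 ->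
    b `^ (1 + p) <= K * (a - b) -> a `^ (- p) + mu <= b `^ (- p).
Proof.
move=> p0 K0.
have two_p : 1 < 2 `^ p :> R.
  rewrite -[ltLHS](_ : 1 `^ p = 1); last by rewrite powR1.
  by apply: gt0_ltr_powR; rewrite ?nnegrE; lra.
(* If a <= 2b, the tangent gain p a^-(1+p) (a - b) is at least the first entry, by a^-(1+p) >=
   (2b)^-(1+p) and [hK]. Otherwise b^-p >= 2^p a^-p, and a^-p >= 1 leaves a gain of 2^p - 1. *)
exists (Num.min (p * 2 `^ (- (1 + p)) / K) (2 `^ p - 1)).
  rewrite lt_min subr_gt0 two_p andbT divr_gt0// mulr_gt0// powR_gt0//; lra.
move=> a b b0 ba a1 hK.
have a0 : 0 < a by exact: lt_le_trans ba.
have [a2b|a2b] := leP a (2 * b).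
  apply: le_trans (powRN_tangent p0 a0 b0); rewrite lerD2l ge_min.
  apply/orP; left; rewrite ler_pdivrMr// -!mulrA ler_pM2l//.
  have ab : (2 * b) `^ (- (1 + p)) <= a `^ (- (1 + p)).
    rewrite !powRN lef_pV2 ?posrE ?powR_gt0//; last by lra.
    by apply: ge0_ler_powR => //; rewrite ?nnegrE; lra.
  rewrite [_ * K]mulrC; apply: le_trans (ler_wpM2r _ ab); last first.
    by rewrite mulr_ge0 ?subr_ge0// ltW.
  rewrite powRM ?(ltW b0)// -mulrA ler_peMr ?powR_ge0//.
  by rewrite [b `^ _]powRN ler_pdivlMl ?powR_gt0// mulr1.
have tb : (2 * b) `^ p <= a `^ p.
  by apply: ge0_ler_powR; rewrite ?nnegrE; lra.
have ap1 : a `^ p <= 1.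
  rewrite -[leRHS](_ : 1 `^ p = 1); last by rewrite powR1.
  by apply: ge0_ler_powR; rewrite ?nnegrE; lra.
rewrite -lerBrDl ge_min; apply/orP; right.
rewrite !powRN -subr_ge0.
rewrite powRM ?(ltW b0)// in tb.
have A0 := powR_gt0 p a0; have B0 := powR_gt0 p b0.
set A := a `^ p in tb ap1 A0 |- *; set B := b `^ p in tb B0 |- *.
have h1 : 2 `^ p / A <= B^-1 by rewrite ler_pdivrMr// ler_pdivlMl// mulrC.
have h2 : 1 <= A^-1 by rewrite invf_ge1.
nra.
Qed.

(** * Sequences satisfying a KL inequality *)

(** The tangent of t^q at [r] gives r^q - r'^q >= q r^(q-1) (r - r'). Descent bounds r - r' below by
    a s'^2, and the KL inequality bounds r^(1-q) above by b s, so s'^2 <= B (r^q - r'^q) s with B =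
    b/(qa). *)
Lemma desingularized_step (R : realType) (q a b r r' s s' : R) :
  0 < q < 1 -> 0 < a -> 0 < b -> 0 < r -> 0 <= r' -> 0 <= s -> 0 <= s' ->
  r `^ (1 - q) <= b * s -> r' + a * s' ^+ 2 <= r ->
  2 * s' <= s + b / (q * a) * (r `^ q - r' `^ q).
Proof.
move=> q01 a0 b0 r0 r'0 s0 s'0 hb ha.
have [q0 q1] := andP q01.
have := powR_tangent q01 r0 r'0.
have -> : r `^ (q - 1) = (r `^ (1 - q))^-1 by rewrite -powRN opprB.
have := powR_gt0 (1 - q) r0.
move: (r `^ (1 - q)) hb => P hb P0.
set D := r `^ q - r' `^ q => hD.
have D1 : q * a * s' ^+ 2 <= D * P.
  have : q * (r - r') / P <= D.
    have E : q * P^-1 * (r' - r) = - (q * (r - r') / P) by ring.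
    by move: hD; rewrite E /D; lra.
  rewrite ler_pdivrMr//; apply: le_trans.
  by rewrite -mulrA ler_pM2l// lerBrDl.
have D0 : 0 <= D.
  by rewrite -(pmulr_lge0 _ P0) (le_trans _ D1)// mulr_ge0 ?sqr_ge0// mulr_ge0 ?ltW.
have qa0 : 0 < q * a by rewrite mulr_gt0.
have D2 : q * a * s' ^+ 2 <= D * b * s.
  by apply: le_trans D1 _; rewrite -mulrA ler_wpM2l.
have D3 : s' ^+ 2 <= b / (q * a) * D * s.
  rewrite -(ler_pM2l qa0); apply: le_trans D2 _.
  by rewrite le_eqVlt; apply/orP; left; apply/eqP; field; lra.
(* AM-GM: s'^2 <= E s implies 2 s' <= s + E *)
have : 0 <= b / (q * a) * D by rewrite mulr_ge0// divr_ge0// ltW.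
move: (b / (q * a) * D) D3 => E D3 E0.
rewrite leNgt; apply/negP => lt_s'.
have : (s + E) ^+ 2 < (2 * s') ^+ 2 by rewrite ltr_pXn2r ?nnegrE// ?addr_ge0 ?mulr_ge0.
have := sqr_ge0 (s - E); nra.
Qed.

Section KL_sequence.
Context (R : realType) (V : normedModType R).
Variables (q a b : R) (r s : nat -> R) (x : nat -> V) (l : V).
Hypotheses (q01 : 0 < q < 1) (a0 : 0 < a) (b0 : 0 < b).
Hypotheses (r_gt0 : forall k, 0 < r k) (s_ge0 : forall k, 0 <= s k).
Hypothesis descent : forall k, r k.+1 + a * s k ^+ 2 <= r k.
Hypothesis KL_ineq : forall k, r k.+1 `^ (1 - q) <= b * s k.
Hypothesis x_step : forall k, `|x k.+1 - x k| <= s k.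
Hypothesis x_cvg : x k @[k --> \oo] --> l.

Let B := b / (q * a).

Let B_gt0 : 0 < B.
Proof. by have [q0 q1] := andP q01; rewrite divr_gt0 ?mulr_gt0. Qed.

(** The potential s_j + B r_(j+1)^q drops by at least s_(j+1) at each step, which pays for the
    distance travelled from x_(k+1). *)
Lemma path_bound k n :
  `|x (k.+1 + n)%N - x k.+1| + s (k + n)%N + B * r (k + n).+1 `^ q
    <= s k + B * r k.+1 `^ q.
Proof.
elim: n => [|n IH]; first by rewrite !addn0 subrr normr0 add0r.
apply: le_trans IH; rewrite !addnS addSn.
have := desingularized_step q01 a0 b0 (r_gt0 _) (ltW (r_gt0 _)) (s_ge0 _)
  (s_ge0 _) (KL_ineq (k + n)) (descent (k + n).+1).
rewrite -/B mulrBr => st.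
have := ler_normD (x (k + n).+2 - x (k + n).+1) (x (k + n).+1 - x k.+1).
rewrite addrA subrK => tri.
have := x_step (k + n).+1.
lra.
Qed.

(** Let n tend to infinity in [path_bound]; descent and r_(k+1) > 0 give s_k <= sqrt(r_k / a). *)
Lemma limit_distance k :
  `|x k.+1 - l| <= (Num.sqrt a)^-1 * Num.sqrt (r k) + B * r k `^ q.
Proof.
have [q0 q1] := andP q01.
have r_le : r k.+1 <= r k.
  by apply: le_trans (descent k); rewrite lerDl mulr_ge0 ?sqr_ge0// ltW.
have s_le : s k <= (Num.sqrt a)^-1 * Num.sqrt (r k).
  rewrite ler_pdivlMl ?sqrtr_gt0// -(ger0_norm (s_ge0 k)) -sqrtr_sqr -sqrtrM ?(ltW a0)//.
  by apply: ler_wsqrtr; apply: le_trans (descent k); rewrite lerDr ltW.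
apply: (@le_trans _ _ (s k + B * r k.+1 `^ q)); last first.
  apply: lerD => //; rewrite ler_pM2l//.
  by apply: ge0_ler_powR; rewrite ?nnegrE ?(ltW (r_gt0 _)) ?(ltW q0).
have cv : `|x (k.+1 + n)%N - x k.+1| @[n --> \oo] --> `|l - x k.+1|.
  apply: cvg_norm; apply: cvgB; last exact: cvg_cst.
  by under eq_fun do rewrite addnC; have := x_cvg; rewrite -(cvg_shiftn k.+1).
rewrite distrC; apply: cvgr_to_le cv _; near=> n.
apply: le_trans (path_bound k n).
by rewrite -addrA lerDl addr_ge0// mulr_ge0 ?powR_ge0// ltW.
Unshelve. all: by end_near. Qed.

Let K := b ^+ 2 / a.

Let K_gt0 : 0 < K. Proof. by rewrite divr_gt0// exprn_gt0. Qed.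

(** Square the KL inequality and use s_k^2 <= (r_k - r_(k+1)) / a. *)
Lemma value_drop k : r k.+1 `^ (2 * (1 - q)) <= K * (r k - r k.+1).
Proof.
rewrite mulrC powRrM powR_mulrn ?powR_ge0//.
apply: (@le_trans _ _ ((b * s k) ^+ 2)).
  by rewrite lerXn2r// nnegrE ?powR_ge0// mulr_ge0// ltW.
have -> : K * (r k - r k.+1) = b ^+ 2 * ((r k - r k.+1) / a) by rewrite /K; ring.
rewrite exprMn ler_pM2l ?exprn_gt0// ler_pdivlMr// mulrC.
by rewrite lerBrDl.
Qed.

Hypothesis r0_le1 : r 0%N <= 1.

(** Below 1, the smaller exponent gives the larger power; this decides which of r^(1/2) and r^q
    dominates in [limit_distance]. *)
Lemma value_le1 k : r k <= 1.
Proof.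
elim: k => // k; apply: le_trans; apply: le_trans (descent k).
by rewrite lerDl mulr_ge0 ?sqr_ge0// ltW.
Qed.

(** Here 2(1 - q) <= 1, so r_(k+1) <= K (r_k - r_(k+1)) and the values contract by K/(1 + K). The
    distance is governed by the square root of r_k. *)
Lemma linear_rate : 2^-1 <= q -> exists c eta : R,
  [/\ 0 < c, 0 < eta < 1 & forall k, `|x k.+1 - l| <= c * eta ^+ k].
Proof.
move=> q2; pose rho := K / (1 + K).
have K1 : 0 < 1 + K by rewrite addr_gt0.
have rho0 : 0 < rho by rewrite divr_gt0.
have rho1 : rho < 1 by rewrite ltr_pdivrMr// mul1r ltrDr.
exists ((Num.sqrt a)^-1 + B), (Num.sqrt rho); split.
- by rewrite addr_gt0// invr_gt0 sqrtr_gt0.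
- by rewrite sqrtr_gt0 rho0 -[ltRHS]sqrtr1 ltr_sqrt.
move=> k.
have r_le j : r j.+1 <= rho * r j.
  rewrite mulrAC ler_pdivlMr//.
  have : r j.+1 <= r j.+1 `^ (2 * (1 - q)).
    rewrite -[leLHS]powRr1 ?(ltW (r_gt0 _))//; apply: ger_powR; last lra.
    by rewrite r_gt0 value_le1.
  by have := value_drop j; nra.
have sqrt_le : Num.sqrt (r k) <= Num.sqrt rho ^+ k.
  elim: k => [|k IH]; first by rewrite expr0 -[leRHS]sqrtr1 ler_wsqrtr.
  apply: le_trans (ler_wsqrtr (r_le k)) _.
  by rewrite sqrtrM ?(ltW rho0)// exprS ler_wpM2l ?sqrtr_ge0.
apply: le_trans (limit_distance k) _.
rewrite mulrDl lerD// ler_pM2l ?invr_gt0 ?sqrtr_gt0//.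
apply: le_trans sqrt_le; rewrite -powR12_sqrt ?(ltW (r_gt0 _))//.
by apply: ger_powR; rewrite // r_gt0 value_le1.
Qed.

(** With p = 1 - 2q > 0 the exponent in [value_drop] is 1 + p, so r_k^-p grows by at least [mu] per
    step and r_k^p <= 1/(k mu). The distance is governed by r_k^q, the power q/p of r_k^p. *)
Lemma sublinear_rate : q < 2^-1 -> exists2 c : R, 0 < c &
  forall k, (0 < k)%N -> `|x k.+1 - l| <= c * k%:R `^ (- (q / (1 - 2 * q))).
Proof.
move=> q2; have [q0 q1] := andP q01.
set p := 1 - 2 * q; have p0 : 0 < p by rewrite /p; lra.
have [mu mu0 hmu] := inverse_power_increment p0 K_gt0.
exists (((Num.sqrt a)^-1 + B) * mu `^ (- (q / p))).
  by rewrite mulr_gt0 ?powR_gt0// addr_gt0// invr_gt0 sqrtr_gt0.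
have r_mono k : r k.+1 <= r k.
  by apply: le_trans (descent k); rewrite lerDl mulr_ge0 ?sqr_ge0// ltW.
have r_inv k : k%:R * mu <= r k `^ (- p).
  elim: k => [|k IH]; first by rewrite mul0r powR_ge0.
  rewrite -natr1 mulrDl mul1r.
  apply: le_trans (hmu _ _ (r_gt0 k.+1) (r_mono k) (value_le1 k) _).
    by rewrite lerD2r.
  have -> : 1 + p = 2 * (1 - q) by rewrite /p; lra.
  exact: value_drop.
move=> k k0.
have kmu0 : 0 < k%:R * mu by rewrite mulr_gt0// ltr0n.
have rq : r k `^ q <= mu `^ (- (q / p)) * k%:R `^ (- (q / p)).
  have rp : r k `^ p <= (k%:R * mu) `^ (-1).
    rewrite powR_inv1 ?(ltW kmu0)// -[leLHS]invrK lef_pV2 ?posrE ?invr_gt0 ?powR_gt0//.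
    by rewrite -powRN.
  have -> : r k `^ q = (r k `^ p) `^ (q / p).
    by rewrite -powRrM mulrC divfK// gt_eqF.
  rewrite -powRM ?(ltW mu0)// [mu * _]mulrC -mulN1r [leRHS]powRrM.
  by apply: ge0_ler_powR; rewrite ?nnegrE ?powR_ge0// divr_ge0// ltW.
apply: le_trans (limit_distance k) _; rewrite -[leRHS]mulrA mulrDl lerD//; last first.
  by rewrite ler_pM2l.
rewrite ler_pM2l ?invr_gt0 ?sqrtr_gt0//; apply: le_trans rq.
rewrite -powR12_sqrt ?(ltW (r_gt0 _))//.
by apply: ger_powR; rewrite ?(ltW q2)// r_gt0 value_le1.
Qed.

End KL_sequence.

(** * Gradients and subdifferentials *)

Section euclidean_norm.
Context {R : realType} {d : nat}.
Implicit Types (u v w : 'rV[R]_d).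

Lemma dotvBl u v w : dotv (u - v) w = dotv u w - dotv v w.
Proof. by rewrite /dotv -sumrB; apply: eq_bigr => i _; rewrite !mxE mulrBl. Qed.

Lemma dotvNr u v : dotv u (- v) = - dotv u v.
Proof. by rewrite /dotv -sumrN; apply: eq_bigr => i _; rewrite !mxE mulrN. Qed.

Lemma dotvDr u v w : dotv u (v + w) = dotv u v + dotv u w.
Proof. by rewrite /dotv -big_split; apply: eq_bigr => i _; rewrite !mxE mulrDr. Qed.

Lemma dotvZl (a : R) u v : dotv (a *: u) v = a * dotv u v.
Proof. by rewrite /dotv big_distrr; apply: eq_bigr => i _; rewrite /= !mxE mulrA. Qed.

Lemma dotvZr (a : R) u v : dotv u (a *: v) = a * dotv u v.
Proof. by rewrite /dotv big_distrr; apply: eq_bigr => i _; rewrite /= !mxE mulrCA. Qed.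

Lemma dotv0r u : dotv u 0 = 0.
Proof. by rewrite /dotv big1// => i _; rewrite mxE mulr0. Qed.

Lemma dotv_delta u j : dotv u (delta_mx 0 j) = u 0 j.
Proof.
rewrite /dotv (bigD1 j)//= big1 ?addr0 => [|i /negPf ij].
  by rewrite mxE !eqxx mulr1.
by rewrite mxE ij andbF mulr0.
Qed.

Lemma dotv_inj u v : (forall w, dotv u w = dotv v w) -> u = v.
Proof. by move=> uv; apply/rowP => j; rewrite -!dotv_delta. Qed.

Lemma cvg_dotv (us vs : nat -> 'rV[R]_d) u v :
  us k @[k --> \oo] --> u -> vs k @[k --> \oo] --> v ->
  dotv (us k) (vs k) @[k --> \oo] --> dotv u v.
Proof.
move=> cu cv; rewrite /dotv; apply: (@cvg_big _ _ +%R); first exact: add_continuous.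
move=> i _; apply: cvgM.
  exact: (continuous_cvg _ (@coord_continuous R 1 d 0 i u) cu).
exact: (continuous_cvg _ (@coord_continuous R 1 d 0 i v) cv).
Qed.

Lemma enorm_ge0 v : 0 <= enorm v.
Proof. exact: sqrtr_ge0. Qed.

Lemma enorm0 : enorm (0 : 'rV[R]_d) = 0.
Proof. by rewrite /enorm dotv0r sqrtr0. Qed.

Lemma enormN v : enorm (- v) = enorm v.
Proof. by congr Num.sqrt; apply: eq_bigr => i _; rewrite !mxE mulrNN. Qed.

Lemma coord_le_enorm v i : `|v 0 i| <= enorm v.
Proof.
rewrite -sqrtr_sqr ler_wsqrtr// /dotv (bigD1 i)//= lerDl.
by apply: sumr_ge0 => j _; rewrite -expr2 sqr_ge0.
Qed.

Lemma norm_le_enorm v : `|v| <= enorm v.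
Proof.
rewrite [leLHS]mx_normrE; apply: bigmax_le; first exact: enorm_ge0.
by move=> [i j] _ /=; rewrite ord1 coord_le_enorm.
Qed.

Lemma enorm_le_norm v : enorm v <= Num.sqrt d%:R * `|v|.
Proof.
have -> : `|v| = Num.sqrt (`|v| ^+ 2) by rewrite sqrtr_sqr ger0_norm.
rewrite -sqrtrM// ler_wsqrtr//.
have -> : d%:R * `|v| ^+ 2 = \sum_(i < d) `|v| ^+ 2.
  by rewrite sumr_const card_ord mulr_natl.
apply: ler_sum => i _; rewrite -expr2 -real_normK ?num_real//.
rewrite lerXn2r ?nnegrE// [leRHS]mx_normrE.
exact: (le_bigmax _ (fun ij : 'I_1 * 'I_d => `|v ij.1 ij.2|) (0, i)).
Qed.

End euclidean_norm.

(** * First-order behaviour of differentiable functions *)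

Section differentiability.
Context {R : realType} {d : nat}.
Implicit Types (F : 'rV[R]_d -> R) (x v w : 'rV[R]_d).

(** [grad] collects partial derivatives; expanding [v] in the standard basis and using linearity of
    the differential recovers every direction. *)
Lemma diff_grad F x v : differentiable F x ->
  'd F x v = dotv (grad (EFin \o F) x) v.
Proof.
move=> dF; rewrite [in LHS](row_sum_delta v) linear_sum.
apply: eq_bigr => i _.
by rewrite linearZ /= mxE deriveE// mulrC.
Qed.

Lemma diff_remainder F x (e : R) : differentiable F x -> 0 < e ->
  \forall y \near x, `|F y - F x - dotv (grad (EFin \o F) x) (y - x)| <= e * `|y - x|.
Proof.
move=> dF e0.
have /eqaddoP/(_ _ e0) h0 := diff_locally dF.
apply/nbhs0P; apply: filterS h0 => z /=.
by rewrite !fctE /= [z + x]addrC opprD addrA [x + z - x]addrAC subrr add0r diff_grad.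
Qed.

(** Divide by t and let t decrease to 0: the quadratic slack vanishes. It serves to differentiate
    convexity-type inequalities along a segment. *)
Lemma derive_right_le F x v (A B : R) : differentiable F x ->
  (forall t, 0 < t <= 1 -> F (x + t *: v) - F x <= t * A + t ^+ 2 * B) ->
  dotv (grad (EFin \o F) x) v <= A.
Proof.
move=> dF hF; rewrite -diff_grad// -deriveE//.
have cv : t^-1 *: ((F \o shift x) (t *: v) - F x) @[t --> 0^'] --> 'D_v F x.
  exact: (diff_derivable dF).
have cv1 : t^-1 *: ((F \o shift x) (t *: v) - F x) - t * B @[t --> 0^'+]
   --> 'D_v F x - 0 * B.
  apply: cvgB; first exact: cvg_dnbhs_at_right.
  by apply: cvg_at_right_filter; apply: cvgM; [exact: cvg_id|exact: cvg_cst].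
rewrite -[leLHS]subr0 -[X in _ - X](mul0r B); apply: cvgr_to_le cv1 _.
near=> t.
have t0 : 0 < t by near: t; exact: nbhs_right_gt.
have t1 : t <= 1 by near: t; exact: nbhs_right_le.
have := hF t; rewrite t0 t1 => /(_ isT) hFt.
rewrite lerBlDr /= [_ + x]addrC /GRing.scale /= ler_pdivrMl//.
by apply: le_trans hFt _; rewrite le_eqVlt; apply/orP; left; apply/eqP; ring.
Unshelve. all: by end_near. Qed.

End differentiability.

(** * Subgradients of smooth and nonsmooth functions *)

Section subdifferentials.
Context {R : realType} {d : nat}.
Implicit Types (F P : 'rV[R]_d -> R) (x w : 'rV[R]_d).

(* The first-order remainder of F at x is bounded below by the one of P, which
   is negligible. *)
Lemma frechet_subdiff_remainder F P x w : differentiable P x ->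
  (forall y, P y - P x - dotv (grad (EFin \o P) x) (y - x)
               <= F y - F x - dotv w (y - x)) ->
  frechet_subdiff (EFin \o F) x w.
Proof.
move=> dP hF; split; first exact: ltry.
(* The lower limit is a supremum of infima over neighborhoods, so for each [e] one neighborhood with
   quotient at least -e suffices. *)
rewrite limf_einfE; apply/lee_addgt0Pr => e e0.
rewrite -leeBlDr// sub0e; apply: ereal_sup_ge.
eexists.
  exists [set y | `|P y - P x - dotv (grad (EFin \o P) x) (y - x)| <= e * `|y - x|] => //.
  by apply: nbhs_dnbhs; exact: diff_remainder.
apply: le_ereal_inf_tmp => _ /= [y hy <-].
rewrite -!EFinB -EFinM lee_fin.
have := hF y; have := norm_le_enorm (y - x).
(* The chosen set may contain [x]; there the inverse of 0 is 0 and the quotient vanishes. *)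
have := enorm_ge0 (y - x); rewrite le_eqVlt => /predU1P[<-|n0].
  by rewrite invr0 mulr0 oppr_le0 (ltW e0).
rewrite ler_pdivlMr// => n1 hFy; apply: le_trans hFy.
move: hy; rewrite ler_norml => /andP[hy _]; apply: le_trans hy.
by rewrite mulNr lerN2 ler_pM2l.
Qed.

(** Differentiating the subgradient inequality from the right in direction [w] gives one inequality
    between inner products; direction -w gives the reverse. *)
Lemma csubdiff_grad F x xi : differentiable F x ->
  csubdiff (EFin \o F) x xi -> xi = grad (EFin \o F) x.
Proof.
move=> dF hxi.
have le w : dotv xi w <= dotv (grad (EFin \o F) x) w.
  have dN : differentiable (- F) x by exact: differentiableN.
  have := @derive_right_le _ _ (- F) x w (- dotv xi w) 0 dN.
  rewrite -diff_grad// diffN// -[X in X <= _]/(- _) diff_grad// lerN2; apply=> t t01.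
  have := hxi (x + t *: w); rewrite /= -!EFinB lee_fin.
  by rewrite [x + _ - x]addrAC subrr add0r dotvZr fctE; lra.
apply: dotv_inj => w; apply/eqP; rewrite eq_le le/=.
by have := le (- w); rewrite !dotvNr lerN2.
Qed.

Lemma lsubdiff_frechet F x w : frechet_subdiff (EFin \o F) x w ->
  lsubdiff (EFin \o F) x w.
Proof.
move=> hw; split; first exact: ltry.
by exists (fun=> x), (fun=> w); split=> //; exact: cvg_cst.
Qed.

(** Subtract F x, divide by t and let t tend to 0. The case c = 0 is plain convexity; strong
    convexity takes c = (sigma/2) |y - x|^2. *)
Lemma uniformly_convex_gradient_ineq F x y (c : R) : differentiable F x ->
  (forall t, 0 <= t <= 1 ->
    F (t *: y + (1 - t) *: x) + t * (1 - t) * c <= t * F y + (1 - t) * F x) ->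
  F x + dotv (grad (EFin \o F) x) (y - x) + c <= F y.
Proof.
move=> dF hF; rewrite -lerBrDr -lerBrDl.
apply: (@derive_right_le _ _ _ _ _ _ c) => // t /andP[t0 t1].
have := hF t; rewrite (ltW t0) t1 => /(_ isT).
have -> : t *: y + (1 - t) *: x = x + t *: (y - x).
  by rewrite scalerBl scale1r scalerBr addrCA.
rewrite -subr_ge0 => h0; rewrite -subr_ge0; apply: le_trans h0 _.
by rewrite le_eqVlt; apply/orP; left; apply/eqP; ring.
Qed.

End subdifferentials.

(** * One step of BPDCA *)

Section bpdca_step.
Context {R : realType} {d : nat}.
Variables (F1 F2 G H : 'rV[R]_d -> R) (L sigma lam : R) (x xi u : 'rV[R]_d).
Let gradF (F : 'rV[R]_d -> R) := grad (EFin \o F).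

Hypothesis lam0 : 0 < lam.
Hypothesis u_min :
  bpdca_map setT (EFin \o F1) (EFin \o G) (EFin \o H) lam x xi u.

Lemma bpdca_map_le v :
  G u + dotv (gradF F1 x - xi) (u - x)
      + lam^-1 * (H u - H x - dotv (gradF H x) (u - x))
  <= G v + dotv (gradF F1 x - xi) (v - x)
      + lam^-1 * (H v - H x - dotv (gradF H x) (v - x)).
Proof. by case: u_min => _ /(_ v); rewrite closureT -lee_fin => /(_ I). Qed.

(** Add three inequalities: minimality tested at [x], the subgradient inequality of [F2], and F1's
    linearization error being at most L D_H(u, x) by convexity of L H - F1. What remains is (1/lam -
    L) D_H(u, x), bounded below by strong convexity. *)
Lemma bpdca_descent :
  differentiable F1 x -> differentiable H x ->
  econvex_on setT (fun y => L%:E * (EFin \o H) y - (EFin \o F1) y)%E ->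
  strongly_convex sigma (EFin \o H) ->
  csubdiff (EFin \o F2) x xi -> lam * L < 1 ->
  F1 u - F2 u + G u + (lam^-1 - L) * (sigma / 2) * enorm (u - x) ^+ 2
    <= F1 x - F2 x + G x.
Proof.
move=> dF1 dH cvxP scH sub2 lamL.
have dP : differentiable (L *: H - F1) x.
  by apply: differentiableB => //; exact: differentiableZ.
have gradP v : dotv (gradF (L *: H - F1) x) v
    = L * dotv (gradF H x) v - dotv (gradF F1 x) v.
  rewrite -!diff_grad// diffB//; last exact: differentiableZ.
  by rewrite diffZ.
have ineqP : F1 u - F1 x - dotv (gradF F1 x) (u - x)
    <= L * (H u - H x - dotv (gradF H x) (u - x)).
  have := @uniformly_convex_gradient_ineq _ _ (L *: H - F1) x u 0 dP.
  rewrite addr0 gradP => ineqP.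
  suff : L * H x - F1 x + (L * dotv (gradF H x) (u - x) - dotv (gradF F1 x) (u - x))
      <= L * H u - F1 u by lra.
  apply: ineqP => t t01; rewrite mulr0 addr0.
  by have := cvxP u x t I I t01; rewrite -lee_fin.
have ineqH : sigma / 2 * enorm (u - x) ^+ 2 <= H u - H x - dotv (gradF H x) (u - x).
  rewrite lerBrDl lerBrDl addrA; apply: uniformly_convex_gradient_ineq => // t t01.
  have := scH u x t t01; rewrite -lee_fin; apply: le_trans.
  by rewrite lee_fin le_eqVlt; apply/orP; left; apply/eqP => /=; ring.
have := bpdca_map_le x; rewrite !subrr !dotv0r subr0 mulr0 !addr0 dotvBl.
have : dotv xi (u - x) <= F2 u - F2 x.
  by have := sub2 u; rewrite /= -!EFinB lee_fin subr_ge0.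
have : 0 < lam^-1 - L by rewrite subr_gt0 -[_^-1]mulr1 ltr_pdivlMl.
nra.
Qed.

(** Minimality bounds G y - G u below by minus the variation of the smooth part of the subproblem.
    Hence the first-order remainder of the objective dominates that of the differentiable function
    F1 - F2 - H/lam. *)
Lemma bpdca_frechet :
  differentiable F1 u -> differentiable F2 u -> differentiable H u ->
  frechet_subdiff (EFin \o (fun y => F1 y - F2 y + G y)) u
    ((gradF F1 u - gradF F1 x) - (gradF F2 u - xi)
       - lam^-1 *: (gradF H u - gradF H x)).
Proof.
move=> dF1 dF2 dH.
have dZ : differentiable (lam^-1 *: H) u by exact: differentiableZ.
have dB : differentiable (F1 - F2) u by exact: differentiableB.
have dP : differentiable (F1 - F2 - lam^-1 *: H) u by exact: differentiableB.
apply: (frechet_subdiff_remainder dP) => y.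
have gradP v : dotv (gradF (F1 - F2 - lam^-1 *: H) u) v
    = dotv (gradF F1 u) v - dotv (gradF F2 u) v - lam^-1 * dotv (gradF H u) v.
  by rewrite -!diff_grad// diffB// diffB// diffZ.
have PE z : (F1 - F2 - lam^-1 *: H) z = F1 z - F2 z - lam^-1 * H z by [].
have := bpdca_map_le y; rewrite gradP !PE.
have -> : y - x = (y - u) + (u - x) by rewrite addrA subrK.
move: (y - u) (u - x) => v1 v2; rewrite !dotvDr !dotvBl dotvZl dotvBl.
nra.
Qed.

End bpdca_step.

(** * Convergence of BPDCA *)

(** The shape is imposed on [0, eta[ only, but this contains a neighborhood of each interior s,
    which determines the derivative. *)
Lemma power_shape_derive1 (R : realType) (theta : R) (eta : \bar R) (phi : R -> R) :
  power_shape theta eta phi -> exists2 c : R, 0 < c &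
  forall s, 0 < s -> (s%:E < eta)%E -> derive1 phi s = c * (1 - theta) * s `^ (- theta).
Proof.
move=> [c c0 phiE]; exists c => // s s0 s_eta.
have s_in : s \in `]0, +oo[ by rewrite in_itv/= s0.
have -> : derive1 phi s = 'D_1 (c \*: (powR (R:=R) ^~ (1 - theta))) s.
  rewrite derive1E; apply: near_eq_derive.
  have s_near : \forall z \near s, 0 < z by exact: lt_nbhsr.
  have s_near' : \forall z \near s, (z%:E < eta)%E.
    case: eta s_eta {phiE} => [e| |//].
      by rewrite lte_fin => s_e; near=> z; rewrite lte_fin; near: z; exact: lt_nbhsl.
    by move=> _; near=> z; exact: ltry.
  near=> z; apply: phiE; split; last by near: z.
  by apply: ltW; near: z.
rewrite deriveZ; last exact: derivable_powR.
by rewrite -derive1E powR_derive1// addrAC subrr add0r /GRing.scale/= mulrA.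
Unshelve. all: by end_near. Qed.

Section bpdca_sequence.
Context {R : realType} {d : nat}.
Variables (F1 F2 G H : 'rV[R]_d -> R) (L sigma lam : R).
Variables (N0 : set 'rV[R]_d) (xs xis : nat -> 'rV[R]_d) (xt : 'rV[R]_d).
Let gradF (F : 'rV[R]_d -> R) := grad (EFin \o F).
Let psi y := F1 y - F2 y + G y.

Hypotheses (lam0 : 0 < lam) (lamL : lam * L < 1) (sigma0 : 0 < sigma).
Hypothesis F1_C1 : C1_on setT (EFin \o F1).
Hypothesis H_C1 : C1_on setT (EFin \o H).
Hypothesis F2_C1 : C1_on N0 (EFin \o F2).
Hypotheses (N0_open : open N0) (xt_N0 : N0 xt).
Hypothesis LHF1_convex :
  econvex_on setT (fun y => L%:E * (EFin \o H) y - (EFin \o F1) y)%E.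
Hypothesis H_strong : strongly_convex sigma (EFin \o H).
Hypotheses (F1_lip : lipschitz_on_bounded (gradF F1))
  (H_lip : lipschitz_on_bounded (gradF H))
  (F2_lip : locally_lipschitz_on (gradF F2) N0).
Hypothesis psi_lsc : lower_semicontinuous (EFin \o psi).
Hypothesis xis_sub : forall k, csubdiff (EFin \o F2) (xs k) (xis k).
Hypothesis xs_min : forall k,
  bpdca_map setT (EFin \o F1) (EFin \o G) (EFin \o H) lam (xs k) (xis k) (xs k.+1).
Hypothesis xs_cvg : xs k @[k --> \oo] --> xt.

Let delta k := enorm (xs k.+1 - xs k).

(** The subgradient of [psi] at [xs k.+1] supplied by [bpdca_frechet]; once [xs k] lies in [N0], it
    consists of gradient differences between consecutive iterates. *)
Let w k := (gradF F1 (xs k.+1) - gradF F1 (xs k))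
  - (gradF F2 (xs k.+1) - xis k) - lam^-1 *: (gradF H (xs k.+1) - gradF H (xs k)).

Let diff_F1 x : differentiable F1 x. Proof. by case: F1_C1 => _ /(_ x I). Qed.
Let diff_H x : differentiable H x. Proof. by case: H_C1 => _ /(_ x I). Qed.
Let diff_F2 x : N0 x -> differentiable F2 x.
Proof. by case: F2_C1 => _ + _; apply. Qed.
Let cont_gradF1 x : {for x, continuous (gradF F1)}.
Proof. by case: F1_C1 => _ _ /(_ x I). Qed.
Let cont_gradH x : {for x, continuous (gradF H)}.
Proof. by case: H_C1 => _ _ /(_ x I). Qed.
Let cont_gradF2 x : N0 x -> {for x, continuous (gradF F2)}.
Proof. by case: F2_C1 => _ _ /(_ x) h /h. Qed.

Lemma succ_cvg : xs k.+1 @[k --> \oo] --> xt.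
Proof. by have := xs_cvg; rewrite -cvg_shiftS. Qed.

Lemma near_N0 : \forall k \near \oo, N0 (xs k).
Proof. by apply: xs_cvg; exact: open_nbhs_nbhs. Qed.

Lemma near_N0S : \forall k \near \oo, N0 (xs k.+1).
Proof. by apply: succ_cvg; exact: open_nbhs_nbhs. Qed.

Lemma xi_grad k : N0 (xs k) -> xis k = gradF F2 (xs k).
Proof. by move=> /diff_F2 dF; exact: csubdiff_grad. Qed.

Let a := (lam^-1 - L) * (sigma / 2).

Lemma descent_const_gt0 : 0 < a.
Proof.
by rewrite mulr_gt0 ?divr_gt0// subr_gt0 -[_^-1]mulr1 ltr_pdivlMl.
Qed.

Lemma psi_descent k : psi (xs k.+1) + a * delta k ^+ 2 <= psi (xs k).
Proof. exact: bpdca_descent. Qed.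

Lemma delta_cvg : delta k @[k --> \oo] --> (0 : R).
Proof.
have cv : Num.sqrt d%:R * `|xs k.+1 - xs k| @[k --> \oo] --> Num.sqrt d%:R * `|xt - xt|.
  apply: cvgM; first exact: cvg_cst.
  by apply: cvg_norm; apply: cvgB xs_cvg; exact: succ_cvg.
rewrite subrr normr0 mulr0 in cv.
apply: squeeze_cvgr cv; last exact: cvg_cst.
by apply: nearW => k; rewrite enorm_ge0 enorm_le_norm.
Qed.

Lemma xi_cvg : xis k @[k --> \oo] --> gradF F2 xt.
Proof.
apply: cvg_trans (continuous_cvg _ (cont_gradF2 xt_N0) xs_cvg).
by apply: near_eq_cvg; apply: filterS near_N0 => k /xi_grad ->.
Qed.

(** As [psi] is only known to be lower semicontinuous, the upper estimate comes from the minimality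
    of [xs k.+1] compared with [xt]. *)
Lemma psi_cvg : psi (xs k) @[k --> \oo] --> psi xt.
Proof.
rewrite -(cvg_shiftS (psi \o xs) (nbhs (psi xt))) /=.
have c1 : F1 (xs k.+1) @[k --> \oo] --> F1 xt.
  exact: continuous_cvg (differentiable_continuous (diff_F1 xt)) succ_cvg.
have c2 : F2 (xs k.+1) @[k --> \oo] --> F2 xt.
  exact: continuous_cvg (differentiable_continuous (diff_F2 xt_N0)) succ_cvg.
have cH : H (xs k.+1) @[k --> \oo] --> H xt.
  exact: continuous_cvg (differentiable_continuous (diff_H xt)) succ_cvg.
have cg1 : gradF F1 (xs k) @[k --> \oo] --> gradF F1 xt.
  exact: continuous_cvg (@cont_gradF1 xt) xs_cvg.
have cgH : gradF H (xs k) @[k --> \oo] --> gradF H xt.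
  exact: continuous_cvg (@cont_gradH xt) xs_cvg.
have cx : xt - xs k.+1 @[k --> \oo] --> xt - xt.
  by apply: cvgB succ_cvg; exact: cvg_cst.
(* This is the bound from testing at [xt] after cancelling the linear terms in xs k.+1 - xs k; [G]
   enters only through the constant G xt, so [U] converges. *)
pose U k := F1 (xs k.+1) - F2 (xs k.+1) + (G xt
  + dotv (gradF F1 (xs k) - xis k) (xt - xs k.+1)
  + lam^-1 * (H xt - H (xs k.+1) - dotv (gradF H (xs k)) (xt - xs k.+1))).
have leU k : psi (xs k.+1) <= U k.
  have := bpdca_map_le (xs_min k) xt; rewrite /psi /U.
  have -> : xt - xs k = (xt - xs k.+1) + (xs k.+1 - xs k) by rewrite addrA subrK.
  rewrite !dotvDr; move: (xt - xs k.+1) (xs k.+1 - xs k) => v1 v2.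
  rewrite !dotvBl; nra.
have cg : gradF F1 (xs k) - xis k @[k --> \oo] --> gradF F1 xt - gradF F2 xt.
  exact: cvgB cg1 xi_cvg.
have cd1 := cvg_dotv cg cx; have cdH := cvg_dotv cgH cx.
have cU : U k @[k --> \oo] --> psi xt.
  have -> : psi xt = F1 xt - F2 xt + (G xt
      + dotv (gradF F1 xt - gradF F2 xt) (xt - xt)
      + lam^-1 * (H xt - H xt - dotv (gradF H xt) (xt - xt))).
    by rewrite !subrr !dotv0r subr0 mulr0 !addr0.
  apply: cvgD; first exact: cvgB c1 c2.
  apply: cvgD; first by apply: cvgD cd1; exact: cvg_cst.
  apply: cvgM; first exact: cvg_cst.
  by apply: cvgB cdH; apply: cvgB cH; exact: cvg_cst.
apply/cvgrPdist_le => e e0.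
have : ((psi xt - e)%:E < (EFin \o psi) xt)%E by rewrite lte_fin ltrBlDr ltrDl.
move=> /psi_lsc[V V_nbhs hV]; near=> k.
rewrite ler_distlC; apply/andP; split.
  by rewrite -lee_fin; apply: ltW; apply: hV; near: k; exact: succ_cvg.
apply: le_trans (leU k) _.
near: k; apply: (cvgr_le _ cU); rewrite ltrDl.
Unshelve. all: by end_near. Qed.

Lemma psi_ge k : psi xt <= psi (xs k).
Proof.
have noninc : {homo psi \o xs : n m / (n <= m)%N >-> m <= n}.
  apply/nonincreasing_seqP => n; apply: le_trans (psi_descent n) => /=.
  by rewrite lerDl mulr_ge0 ?sqr_ge0// ltW// descent_const_gt0.
have := nonincreasing_cvgn_ge noninc (cvgP _ psi_cvg) k.
by rewrite (cvg_lim _ psi_cvg).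
Qed.

Lemma residual_frechet k : N0 (xs k.+1) -> frechet_subdiff (EFin \o psi) (xs k.+1) (w k).
Proof. by move=> /diff_F2 dF; exact: bpdca_frechet. Qed.

(** The gradients of [F1] and [H] are Lipschitz on a ball containing the tail, that of [F2] near
    [xt]. *)
Lemma residual_bound : exists2 M : R, 0 < M &
  \forall k \near \oo, enorm (w k) <= M * delta k.
Proof.
pose B := [set x : 'rV[R]_d | `|x| <= `|xt| + 1].
have B_bounded : bounded_set B.
  apply: filterS (nbhs_pinfty_ge (num_real (`|xt| + 1))) => M leM x Bx.
  exact: le_trans Bx leM.
have [M1 lip1] := F1_lip B_bounded.
have [M3 lip3] := H_lip B_bounded.
have [V V_nbhs [M2 lip2]] := F2_lip xt_N0.
(* The triangle inequality is applied in the sup norm; the square root of d returns to the Euclidean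
   norm. Lipschitz constants carry no sign, hence the maximum with 1 below. *)
pose M := Num.sqrt d%:R * (M1 + M2 + lam^-1 * M3).
exists (Num.max 1 M); first by rewrite lt_max ltr01.
near=> k.
have Bk : B (xs k).
  by near: k; apply: (cvgr_norm_le _ xs_cvg); rewrite ltrDl.
have Bk1 : B (xs k.+1).
  by near: k; apply: (cvgr_norm_le _ succ_cvg); rewrite ltrDl.
have Nk : N0 (xs k) by near: k; exact: near_N0.
have Nk1 : N0 (xs k.+1) by near: k; exact: near_N0S.
have Vk : V (xs k) by near: k; exact: xs_cvg.
have Vk1 : V (xs k.+1) by near: k; exact: succ_cvg.
apply: (@le_trans _ _ (M * delta k)); last first.
  by apply: ler_wpM2r; [exact: enorm_ge0|rewrite le_max lexx orbT].
apply: le_trans (enorm_le_norm _) _.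
rewrite -mulrA ler_wpM2l ?sqrtr_ge0// /w xi_grad//.
have l1 := le_trans (norm_le_enorm _) (lip1 _ _ Bk1 Bk).
have l2 := le_trans (norm_le_enorm _) (lip2 _ _ (conj Vk1 Nk1) (conj Vk Nk)).
have l3 := le_trans (norm_le_enorm _) (lip3 _ _ Bk1 Bk).
apply: le_trans (ler_normB _ _) _; rewrite !mulrDl lerD//.
  by apply: le_trans (ler_normB _ _) _; rewrite lerD.
rewrite normrZ -mulrA ger0_norm ?invr_ge0 ?(ltW lam0)// ler_pM2l ?invr_gt0.
Unshelve. all: by end_near. Qed.

Lemma residual_cvg : w k @[k --> \oo] --> (0 : 'rV[R]_d).
Proof.
have [M M0 wM] := residual_bound.
have cv : M * delta k @[k --> \oo] --> (0 : R).
  by rewrite -(mulr0 M); apply: cvgM; [exact: cvg_cst|exact: delta_cvg].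
apply/cvgr0Pnorm_le => e e0; near=> k.
apply: le_trans (norm_le_enorm _) _.
apply: (@le_trans _ _ (M * delta k)); first by near: k.
by near: k; exact: (cvgr_le _ cv).
Unshelve. all: by end_near. Qed.

(* The residuals themselves witness stationarity, so no sum rule for limiting
   subdifferentials is needed. *)
Lemma limit_stationary : lsubdiff (EFin \o psi) xt 0.
Proof.
split; first exact: ltry.
have [N _ hN] := near_N0S.
(* The limiting subdifferential asks for Frechet subgradients at every index, so the sequences start
   once the iterates stay in [N0]. *)
exists (fun k => xs (k + N).+1), (fun k => w (k + N)%N); split.
- by have := succ_cvg; rewrite -(cvg_shiftn N).
- apply: cvg_EFin; first by apply: nearW.
  by have := psi_cvg; rewrite -(cvg_shiftn N.+1); under eq_fun do rewrite addnS.
- exact: (@cvg_comp _ _ _ (addn^~ N) w _ _ _ (cvg_addnr N) residual_cvg).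
- by move=> k; exact: (@residual_frechet (k + N) (hN _ (leq_addl _ _))).
Qed.

(** * The KL inequality along the iterates and the resulting rates *)

Variable theta : R.
Hypothesis theta1 : theta < 1.
Hypothesis psi_KL : KL_function (power_shape theta) (EFin \o psi).

(** [limit_stationary] puts [xt] in the domain where KL applies. The distance from 0 to the
    subdifferential is at most the norm of [w k], hence M delta_k, and phi' is c (1 - theta)
    s^-theta. *)
Lemma bpdca_KL : exists2 b : R, 0 < b & \forall k \near \oo,
  psi xt < psi (xs k.+1) -> (psi (xs k.+1) - psi xt) `^ theta <= b * delta k.
Proof.
case: psi_KL => _ _ /(_ xt) []; first by exists 0; exact: limit_stationary.
move=> eta [U [phi [eta0 U_nbhs _ phi_shape KL]]].
have [c c0 dphi] := power_shape_derive1 phi_shape.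
have [M M0 wM] := residual_bound.
have b0 : 0 < c * (1 - theta) by rewrite mulr_gt0// subr_gt0.
exists (c * (1 - theta) * M); first by rewrite mulr_gt0.
near=> k => gt_k; rewrite -subr_gt0 in gt_k.
(* The gap tends to 0 by [psi_cvg], so it eventually enters the KL window. *)
have lt_eta : ((psi (xs k.+1) - psi xt)%:E < eta)%E.
  near: k; case: eta eta0 {phi_shape KL dphi} => [e| |//] eta0.
    have cv : psi (xs k.+1) - psi xt @[k --> \oo] --> (0 : R).
      rewrite -(subrr (psi xt)); apply: cvgB; last exact: cvg_cst.
      by have := psi_cvg; rewrite -(cvg_shiftS (psi \o xs)).
    exact: (cvgr_lt _ cv).
  by apply: nearW => k; exact: ltry.
have Uk : U (xs k.+1) by near: k; exact: succ_cvg.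
have := KL _ Uk; rewrite !lte_fin -subr_gt0 => /(_ gt_k).
have -> : ((EFin \o psi) xt + eta = eta + (psi xt)%:E)%E by rewrite addeC.
rewrite -lteBlDr// => /(_ lt_eta).
rewrite -EFinB dphi// => KLk.
have rth : 0 < (psi (xs k.+1) - psi xt) `^ (- theta) by rewrite powR_gt0.
have dist_le : (dist_to_set 0 (lsubdiff (EFin \o psi) (xs k.+1)) <= (M * delta k)%:E)%E.
  apply: (@le_trans _ _ (enorm (0 - w k))%:E).
    apply: ereal_inf_lbound; exists (w k) => //.
    by apply: lsubdiff_frechet; apply: residual_frechet; near: k; exact: near_N0S.
  by rewrite lee_fin sub0r enormN; near: k.
have := le_trans KLk (lee_wpmul2l _ dist_le).
rewrite lee_fin mulr_ge0 ?(ltW b0) ?(ltW rth)// => /(_ isT).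
rewrite -EFinM lee_fin powRN => h1.
rewrite -[leLHS]mul1r -ler_pdivlMr; last by rewrite powR_gt0.
by apply: le_trans h1 _; rewrite le_eqVlt; apply/orP; left; apply/eqP; ring.
Unshelve. all: by end_near. Qed.

(** Values decrease but never pass below psi xt; once that value is reached, descent forces all
    later steps to be zero. *)
Lemma stationary_value_eventually_cst k0 : psi (xs k0) = psi xt ->
  forall k, (k0 <= k)%N -> xs k = xt.
Proof.
move=> psi_k0.
have xs_k0 n : xs (k0 + n)%N = xs k0.
  elim: n => [|n IH]; first by rewrite addn0.
  have := psi_descent (k0 + n)%N; rewrite IH psi_k0 -addnS => desc.
  have : a * delta (k0 + n) ^+ 2 <= 0 by have := psi_ge (k0 + n.+1)%N; lra.
  rewrite pmulr_rle0 ?descent_const_gt0// => d0.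
  have : `|xs (k0 + n).+1 - xs (k0 + n)%N| <= 0.
    apply: le_trans (norm_le_enorm _) _.
    rewrite leNgt; apply/negP => d1; move: d0.
    by rewrite leNgt /delta exprn_gt0.
  by rewrite normr_le0 subr_eq0 addnS => /eqP ->.
have xt_k0 : xt = xs k0.
  apply: (cvg_unique _ xs_cvg) => //; apply: cvg_near_cst.
  by exists k0 => // k /= /subnKC <-.
by move=> k /subnKC <-; rewrite xs_k0.
Qed.

(** A positive gap to the power 0 is 1, which the vanishing b delta_k cannot dominate; so the limit
    value is attained. *)
Lemma bpdca_finite : theta = 0 ->
  exists k0, forall k, (k0 <= k)%N -> xs k = xt.
Proof.
move=> th0; have [b b0 KL] := bpdca_KL.
have small : \forall k \near \oo, b * delta k < 1.
  have cv : b * delta k @[k --> \oo] --> b * 0.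
    by apply: cvgM; [exact: cvg_cst|exact: delta_cvg].
  by apply: (cvgr_lt _ cv); rewrite mulr0.
near \oo => k.
exists k.+1; apply: stationary_value_eventually_cst.
apply/eqP; rewrite eq_le psi_ge andbT leNgt; apply/negP => gt_k.
have h1 : (psi (xs k.+1) - psi xt) `^ theta <= b * delta k.
  by move: gt_k; near: k.
have : b * delta k < 1 by near: k.
by rewrite ltNge; move: h1; rewrite th0 powRr0 => ->.
Unshelve. all: by end_near. Qed.

Hypothesis psi_gt : forall k, psi xt < psi (xs k).

Let q := 1 - theta.

(** Restarting at [m] supplies the KL bound at every index and an initial gap of at most 1, as the
    abstract rates require. *)
Lemma bpdca_KL_tail : exists m (b : R), [/\ 0 < b,
  psi (xs m) - psi xt <= 1 & forall k,
  (psi (xs (m + k).+1) - psi xt) `^ (1 - q) <= b * delta (m + k)].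
Proof.
have [b b0 KL] := bpdca_KL.
have small : \forall k \near \oo, psi (xs k) - psi xt <= 1.
  have cv : psi (xs k) - psi xt @[k --> \oo] --> psi xt - psi xt.
    by apply: cvgB psi_cvg _; exact: cvg_cst.
  by apply: (cvgr_le _ cv); rewrite subrr.
have [m _ hm] : \forall k \near \oo, psi (xs k) - psi xt <= 1 /\
    (psi (xs k.+1) - psi xt) `^ theta <= b * delta k.
  by near=> k; split; [near: k|apply: (near KL k) => //].
exists m, b; split => //; first by case: (hm m (leqnn m)).
by move=> k; rewrite subKr; case: (hm (m + k)%N (leq_addr _ _)).
Unshelve. all: by end_near. Qed.

Let q01 : 0 < theta -> 0 < q < 1. Proof. by move=> th0; rewrite subr_gt0 theta1 ltrBlDr ltrDl. Qed.

Let tail_cvg m : xs (m + k)%N @[k --> \oo] --> xt.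
Proof. exact: (@cvg_comp _ _ _ (addn m) xs _ _ _ (cvg_addnl m) xs_cvg). Qed.

Let r_gt0 m k : 0 < psi (xs (m + k)%N) - psi xt.
Proof. by rewrite subr_gt0. Qed.

Let r_descent m k : psi (xs (m + k.+1)%N) - psi xt + a * delta (m + k) ^+ 2
  <= psi (xs (m + k)%N) - psi xt.
Proof. by rewrite addrAC lerB// addnS psi_descent. Qed.

Let step_le m k : `|xs (m + k.+1)%N - xs (m + k)%N| <= delta (m + k).
Proof. by rewrite addnS norm_le_enorm. Qed.

Lemma bpdca_linear : 0 < theta <= 1 / 2 -> exists (c1 : R) (k1 : nat) (eta : R),
  [/\ 0 < c1, (0 < k1)%N, 0 < eta < 1 &
      forall k : nat, (k1 < k)%N -> enorm (xs k - xt) < c1 * eta ^+ k].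
Proof.
move=> /andP[th0 th2]; have [m [b [b0 m1 KL]]] := bpdca_KL_tail.
have q2 : 2^-1 <= q by rewrite /q; lra.
have [k|k||c [eta [c0 eta01 hc]]] := linear_rate (x := fun k => xs (m + k)%N)
  (q01 th0) descent_const_gt0 b0 (r_gt0 m) _ (r_descent m) _ (step_le m) (@tail_cvg m) _ q2.
- exact: enorm_ge0.
- by rewrite addnS.
- by rewrite addn0.
have [eta0 eta1] := andP eta01.
have D0 : 0 < Num.sqrt d%:R * c + 1 by rewrite ltr_wpDl// mulr_ge0// ?sqrtr_ge0// ltW.
(* The rate for the tail bounds iterate m + j + 2 by c eta^(j+1); dividing by eta^(m+1) restores the
   exponent m + j + 2. The added 1 makes the inequality strict, also when d = 0. *)
exists ((Num.sqrt d%:R * c + 1) / eta ^+ m.+1), m.+1, eta; split=> //.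
  by rewrite divr_gt0// exprn_gt0.
move=> k /subnKC <-; move: (k - m.+2)%N => j.
have -> : eta ^+ (m.+2 + j) = eta ^+ m.+1 * eta ^+ j.+1 by rewrite -exprD addSnnS.
rewrite mulrA divfK ?expf_neq0 ?gt_eqF//.
have -> : (m.+2 + j = m + j.+2)%N by rewrite !addSn !addnS.
apply: le_lt_trans (enorm_le_norm _) _.
apply: le_lt_trans (ler_wpM2l (sqrtr_ge0 _) (hc j.+1)) _.
by rewrite mulrA ltr_pM2r ?exprn_gt0// ltrDl.
Qed.

Lemma bpdca_sublinear : 1 / 2 < theta < 1 -> exists (c2 : R) (k2 : nat),
  [/\ 0 < c2, (0 < k2)%N & forall k : nat, (k2 < k)%N ->
    enorm (xs k - xt) < c2 * k%:R `^ (- ((1 - theta) / (2 * theta - 1)))].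
Proof.
move=> /andP[th2 _]; have [m [b [b0 m1 KL]]] := bpdca_KL_tail.
have q2 : q < 2^-1 by rewrite /q; lra.
have th0 : 0 < theta by lra.
have [k|k||c c0 hc] := sublinear_rate (x := fun k => xs (m + k)%N)
  (q01 th0) descent_const_gt0 b0 (r_gt0 m) _ (r_descent m) _ (step_le m) (@tail_cvg m) _ q2.
- exact: enorm_ge0.
- by rewrite addnS.
- by rewrite addn0.
have -> : (1 - theta) / (2 * theta - 1) = q / (1 - 2 * q).
  by congr (_ / _); rewrite /q; ring.
move: hc; set e := q / (1 - 2 * q) => hc.
have [q0 _] := andP (q01 th0).
have e0 : 0 <= e by apply: divr_ge0; [exact: ltW|lra].
have D0 : 0 < Num.sqrt d%:R * c + 1 by rewrite ltr_wpDl// mulr_ge0 ?sqrtr_ge0// ltW.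
(* The factor (m+2)^e absorbs the index shift, since m + 2 + j <= (m+2)(j+1). *)
exists ((Num.sqrt d%:R * c + 1) * m.+2%:R `^ e), m.+1; split=> //.
  by rewrite mulr_gt0// powR_gt0.
move=> k /subnKC <-; move: (k - m.+2)%N => j.
have -> : xs (m.+2 + j)%N = xs (m + j.+2)%N by rewrite !addSn !addnS.
apply: le_lt_trans (enorm_le_norm _) _.
apply: le_lt_trans (ler_wpM2l (sqrtr_ge0 _) (hc j.+1 isT)) _.
rewrite mulrA; apply: (@lt_le_trans _ _ ((Num.sqrt d%:R * c + 1) * j.+1%:R `^ (- e))).
  by rewrite ltr_pM2r ?powR_gt0// ltrDl.
rewrite -mulrA ler_pM2l// !powRN ler_pdivlMr ?powR_gt0// ler_pdivrMl ?powR_gt0//.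
rewrite -powRM//; apply: ge0_ler_powR; rewrite // ?nnegrE ?mulr_ge0//.
by rewrite -natrM ler_nat mulSn leq_add2l leq_pmulr.
Qed.

End bpdca_sequence.

(** Passes from the extended-valued data of the problem to real functions. *)
Lemma finite_valued (R : realType) (T : Type) (f : T -> \bar R) :
  (forall x, f x \is a fin_num) -> exists F : T -> R, f = EFin \o F.
Proof.
by move=> f_fin; exists (fine \o f); apply/funext => x /=; rewrite fineK.
Qed.

Unset Implicit Arguments.
Set Strict Implicit.
Set Printing Implicit Defensive.

Theorem theorem4 (R : realType) (d : nat) (C : set 'rV[R]_d)
    (f1 f2 g h : 'rV[R]_d -> \bar R) (L sigma lam theta : R)
    (N0 : set 'rV[R]_d) (xs : nat -> 'rV[R]_d) (xtilde : 'rV[R]_d)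
    (C_neq0 : C !=set0) (C_convex : convex_set C) (C_open : open C)
    (basic : basic_assumptions C f1 f2 g h)
    (L_gt0 : 0 < L) (f1h_smad : smad C L f1 h)
    (T_sub_C : forall (x xi : 'rV[R]_d) (lam' : R), C x -> csubdiff f2 x xi -> 0 < lam' ->
       bpdca_map C f1 g h lam' x xi `<=` C)
    (dom_h : dom h = setT)
    (sigma_gt0 : 0 < sigma) (h_strong : strongly_convex sigma h)
    (grad_h_lip : lipschitz_on_bounded (grad h))
    (grad_f1_lip : lipschitz_on_bounded (grad f1))
    (Psi_level : level_bounded (Psi f1 f2 g))
    (N0_open : open N0) (N0_crit : limiting_critical f1 f2 g `<=` N0)
    (f2_C1 : C1_on N0 f2) (grad_f2_lip : locally_lipschitz_on (grad f2) N0)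
    (lamL : 0 < lam * L < 1)
    (xs_bpdca : is_BPDCA C f1 f2 g h lam xs)
    (xtilde_crit : limiting_critical f1 f2 g xtilde)
    (xs_cvg : xs k @[k --> \oo] --> xtilde)
    (theta_ge0 : 0 <= theta) (theta_lt1 : theta < 1)
    (Psi_KL : KL_function (power_shape theta) (Psi f1 f2 g)) :
  [/\ theta = 0 ->
        exists2 k0 : nat, (0 < k0)%N &
          forall k l : nat, (k0 < k)%N -> (k0 < l)%N -> xs k = xs l,
      0 < theta <= 1 / 2 ->
        exists (c1 : R) (k1 : nat) (eta : R),
          [/\ 0 < c1, (0 < k1)%N, 0 < eta < 1 &
              forall k : nat, (k1 < k)%N -> enorm (xs k - xtilde) < c1 * eta ^+ k] &
      1 / 2 < theta < 1 ->
        exists (c2 : R) (k2 : nat),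
          [/\ 0 < c2, (0 < k2)%N &
              forall k : nat, (k2 < k)%N ->
                enorm (xs k - xtilde)
                  < c2 * k%:R `^ (- ((1 - theta) / (2 * theta - 1)))]].
Proof.
have CT : C = setT by rewrite -(kgd_int_dom (ba_kernel basic)) dom_h interiorT.
subst C.
have h_fin x : h x \is a fin_num.
  by case: (kgd_C1 (ba_kernel basic)) => + _ _; exact.
have f1_fin x : f1 x \is a fin_num by case: (smad_C1 f1h_smad) => + _ _; exact.
have g_fin x : g x \is a fin_num.
  have : dom h x by rewrite dom_h.
  move/(ba_f1_dom basic); rewrite /dom/=.
  have [+ _] := ba_g_proper basic => /(_ x).
  by have := f1_fin x; case: (f1 x) => // r _; case: (g x).
(* As [f1] and [g] are finite, an infinite [f2] would make [Psi] equal to -oo, against the lower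
   bound on the value of the problem. *)
have f2_fin x : f2 x \is a fin_num.
  have : (-oo < Psi f1 f2 g x)%E.
    apply: lt_le_trans (ba_value basic) _; apply: ereal_inf_lbound.
    by exists x => //; rewrite closureT.
  have [+ _] := ba_f2_proper basic => /(_ x).
  rewrite /Psi; have := f1_fin x; case: (f1 x) => // r _.
  by have := g_fin x; case: (g x) => // s _; case: (f2 x).
have [H hE] := finite_valued h_fin; subst h.
have [F1 f1E] := finite_valued f1_fin; subst f1.
have [G gE] := finite_valued g_fin; subst g.
have [F2 f2E] := finite_valued f2_fin; subst f2.
have lam0 : 0 < lam by have [+ _] := andP lamL; rewrite pmulr_lgt0.
have lamL1 : lam * L < 1 by have [] := andP lamL.
have [_ [xis xis_min]] := xs_bpdca.
have [_ psi_lsc _] := Psi_KL.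
have F1_C1 := smad_C1 f1h_smad.
have H_C1 := kgd_C1 (ba_kernel basic).
have cvxP := smad_minus f1h_smad.
have xt_N0 := N0_crit _ xtilde_crit.
have xis_sub k : csubdiff (EFin \o F2) (xs k) (xis k) by case: (xis_min k).
have xs_min k := (xis_min k).2.
(* The abstract rates require positive gaps. If a gap vanishes, the sequence is eventually constant
   and all three claims are immediate. *)
have [[k0 psi_k0]|psi_gt] := pselect (exists k0, F1 (xs k0) - F2 (xs k0) + G (xs k0)
    = F1 xtilde - F2 xtilde + G xtilde).
  have xs_eq := stationary_value_eventually_cst lam0 lamL1 sigma_gt0 F1_C1 H_C1
    f2_C1 N0_open xt_N0 cvxP h_strong psi_lsc xis_sub xs_min xs_cvg psi_k0.
  have enorm_k k : (k0.+1 < k)%N -> enorm (xs k - xtilde) = 0.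
    by move=> k0k; rewrite xs_eq ?subrr ?enorm0// ltnW// ltnW.
  split.
  (* The successor only serves to make the index positive. *)
  - move=> _; exists k0.+1 => // k l k0k k0l.
    by rewrite !xs_eq// ltnW// ltnW.
  - move=> _; exists 1, k0.+1, 2^-1; split=> //; first lra.
    by move=> k /enorm_k ->; rewrite mul1r exprn_gt0.
  - move=> _; exists 1, k0.+1; split=> // k k0k; rewrite enorm_k// mul1r powR_gt0//.
    by rewrite ltr0n (leq_trans _ k0k).
have psi_gt' k : F1 xtilde - F2 xtilde + G xtilde < F1 (xs k) - F2 (xs k) + G (xs k).
  rewrite lt_neqAle (psi_ge lam0 lamL1 sigma_gt0 F1_C1 H_C1
    f2_C1 N0_open xt_N0 cvxP h_strong psi_lsc xis_sub xs_min xs_cvg) andbT.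
  by apply/negP => /eqP psi_k; apply: psi_gt; exists k.
split.
- move=> theta0.
  have [k0 xs_eq] := bpdca_finite lam0 lamL1 sigma_gt0 F1_C1 H_C1 f2_C1 N0_open
    xt_N0 cvxP h_strong grad_f1_lip grad_h_lip grad_f2_lip psi_lsc xis_sub xs_min
    xs_cvg theta_lt1 Psi_KL theta0.
  exists k0.+1 => // k l k0k k0l.
  by rewrite !xs_eq// ltnW// ltnW.
- exact: (bpdca_linear lam0 lamL1 sigma_gt0 F1_C1 H_C1 f2_C1 N0_open
    xt_N0 cvxP h_strong grad_f1_lip grad_h_lip grad_f2_lip psi_lsc xis_sub xs_min
    xs_cvg theta_lt1 Psi_KL psi_gt').
- exact: (bpdca_sublinear lam0 lamL1 sigma_gt0 F1_C1 H_C1 f2_C1 N0_open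
    xt_N0 cvxP h_strong grad_f1_lip grad_h_lip grad_f2_lip psi_lsc xis_sub xs_min
    xs_cvg theta_lt1 Psi_KL psi_gt').
Qed.
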